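(* Let $\mathrm{FS}$ be the set of fine associative spectra of linear quasigroups, partially ordered by inclusion. Then $\mathrm{FS}$ is a lattice, and the map $\Psi\colon \mathrm{Sub}_2(\mathbb{Z}\times\mathbb{Z})\cup\{\{(0,0)\}\}\to\mathrm{FS}$, $\Lambda\mapsto{\sim_\Lambda}$, is an order isomorphism (the domain ordered by inclusion) that preserves meets.
   Context: A binary tree is a finite rooted plane tree in which every internal vertex has exactly two ordered children (left and right); $\mathcal{T}_n$ is the set of binary trees with $n$ leaves, leaves numbered $1,\dots,n$ from left to right. The left depth $\mathrm{ld}_T(i)$ (right depth $\mathrm{rd}_T(i)$) of a leaf $i$ is the number of steps to a left (right) child on the path from the root to $i$. A bracketing of size $n$ is a fully parenthesised product of $x_1,\dots,x_n$ in this order; bracketings of size $n$ correspond bijectively to trees in $\mathcal{T}_n$ via $\tau(x_i)=$ one-vertex tree and $\tau((t_1t_2))=$ tree with root whose left subtree is $\tau(t_1)$ and right subtree $\tau(t_2)$, and relations on bracketings and trees are identified via $\tau$. The fine associative spectrum of a groupoid $\mathbf{A}$ is the equivalence relation on the set of all bracketings (each $B_n$ being a union of classes) relating bracketings $t,t'$ of the same size iff $\mathbf{A}$ satisfies $t\approx t'$. A linear quasigroup is a groupoid $(A,\circ)$ with $x\circ y=\varphi_0(x)+\varphi_1(y)$ for some (not necessarily abelian) group $(A,+)$ and automorphisms $\varphi_0,\varphi_1$ of it. For a subgroup $\Lambda\le\mathbb{Z}\times\mathbb{Z}$, ${\sim_\Lambda}$ relates $T,T'\in\mathcal{T}_n$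 iff $(\mathrm{ld}_T(i)-\mathrm{ld}_{T'}(i),\mathrm{rd}_T(i)-\mathrm{rd}_{T'}(i))\in\Lambda$ for all $i$. $\mathrm{Sub}_2(\mathbb{Z}\times\mathbb{Z})$ is the set of two-dimensional subgroups of $\mathbb{Z}\times\mathbb{Z}$, i.e. those generated by two linearly independent vectors. ''Preserves meets'' means $\Psi(\Lambda_1\cap\Lambda_2)=\Psi(\Lambda_1)\cap\Psi(\Lambda_2)$. *)

(* Defs.v *)
From mathcomp Require Import all_boot all_order all_algebra.
From mathcomp Require Import boolp classical_sets functions.

Set Implicit Arguments.
Unset Strict Implicit.
Unset Printing Implicit Defensive.

Import Order.TTheory GRing.Theory Num.Theory.
Local Open Scope classical_set_scope.
Local Open Scope ring_scope.

Inductive btree : Type :=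
| Leaf
| Node of btree & btree.

Fixpoint leaves (T : btree) : nat :=
  if T is Node l r then (leaves l + leaves r)%N else 1%N.

(* Leaves are numbered 1, ..., leaves T from left to right; the values of
   [ld] and [rd] at other indices are meaningless. *)
Fixpoint ld (T : btree) (i : nat) : nat :=
  if T is Node l r then
    if (i <= leaves l)%N then (ld l i).+1 else ld r (i - leaves l)%N
  else 0%N.

Fixpoint rd (T : btree) (i : nat) : nat :=
  if T is Node l r then
    if (i <= leaves l)%N then rd l i else (rd r (i - leaves l)%N).+1
  else 0%N.

Inductive term : Type :=
| Var of nat
| Mul of term & term.

Fixpoint eval (A : Type) (op : A -> A -> A) (v : nat -> A) (t : term) : A :=
  match t with
  | Var i => v i
  | Mul s u => op (eval op v s) (eval op v u)
  end.

Definition satisfies (A : Type) (op : A -> A -> A) (t t' : term) : Prop :=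
  forall v : nat -> A, eval op v t = eval op v t'.

(* The bracketing, with variables x_k, x_(k+1), ..., whose tree is T. *)
Fixpoint bracketing_from (k : nat) (T : btree) : term :=
  if T is Node l r then
    Mul (bracketing_from k l) (bracketing_from (k + leaves l)%N r)
  else Var k.

Definition bracketing (T : btree) : term := bracketing_from 1 T.

(* Bracketings being identified with trees, a relation on the set of all
   bracketings is a set of pairs of trees; = and `<=` on such sets are
   extensional equality and inclusion of relations. *)
Definition tree_rel : Type := set (btree * btree).

Definition fine_spectrum (A : Type) (op : A -> A -> A) : tree_rel :=
  [set p | leaves p.1 = leaves p.2 /\
           satisfies op (bracketing p.1) (bracketing p.2)].

Definition is_automorphism (G : groupType) (phi : G -> G) : Prop :=
  {morph phi : x y / (x * y)%g} /\ bijective phi.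

(* [groupType] is the type of arbitrary, possibly infinite and nonabelian
   groups; the group operation, usually written + here, is its [*]. *)
Definition linear_quasigroup (G : groupType) (op : G -> G -> G) : Prop :=
  exists phi0 phi1 : G -> G,
    [/\ is_automorphism phi0, is_automorphism phi1
      & forall x y, op x y = (phi0 x * phi1 y)%g].

Definition FS : set tree_rel :=
  [set R | exists (G : groupType) (op : G -> G -> G),
             linear_quasigroup op /\ R = fine_spectrum op].

Definition subgroup : set (set (int * int)) :=
  [set L | L 0 /\ forall u v, L u -> L v -> L (u - v)].

Definition lin_indep (u v : int * int) : Prop :=
  forall a b : int, u *~ a + v *~ b = 0 -> a = 0 /\ b = 0.

Definition Sub2 : set (set (int * int)) :=
  [set L | exists u v, lin_indep u v /\ L = smallest subgroup [set u; v]].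

(* The domain of Psi; the second member is the singleton of the trivial
   subgroup. *)
Definition Sub2_0 : set (set (int * int)) := Sub2 `|` [set [set 0]].

Definition sim (L : set (int * int)) : tree_rel :=
  [set p | leaves p.1 = leaves p.2 /\
     forall i : nat, (1 <= i <= leaves p.1)%N ->
       L ((ld p.1 i)%:Z - (ld p.2 i)%:Z, (rd p.1 i)%:Z - (rd p.2 i)%:Z)].

(* For a family P of sets ordered by inclusion: glb and lub within P. *)
Definition is_glb_in (X : Type) (P : set (set X)) (A B M : set X) : Prop :=
  [/\ P M, M `<=` A, M `<=` B
    & forall C, P C -> C `<=` A -> C `<=` B -> C `<=` M].

Definition is_lub_in (X : Type) (P : set (set X)) (A B J : set X) : Prop :=
  [/\ P J, A `<=` J, B `<=` J
    & forall C, P C -> A `<=` C -> B `<=` C -> J `<=` C].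

Definition is_lattice (X : Type) (P : set (set X)) : Prop :=
  forall A B, P A -> P B ->
    (exists M, is_glb_in P A B M) /\ (exists J, is_lub_in P A B J).

Definition order_iso (X Y : Type) (P : set (set X)) (Q : set (set Y))
    (f : set X -> set Y) : Prop :=
  set_bij P Q f /\
  forall A B, P A -> P B -> (A `<=` B <-> f A `<=` f B).

(* The first conjunct says that f is defined, as a map on P, at A `&` B. *)
Definition preserves_meets (X Y : Type) (P : set (set X))
    (f : set X -> set Y) : Prop :=
  forall A B, P A -> P B -> P (A `&` B) /\ f (A `&` B) = f A `&` f B.

(* Main.v *)
(** In a linear quasigroup a bracketing evaluates to the ordered product of
    the images of its variables under their addresses, words in the
    automorphisms [a] and [b], so two bracketings agree iff all their
    addresses do. Along a tree, the quotient of two consecutive addresses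
    depends only on the differences of the left and right depths; hence the
    spectrum is [sim M] for the subgroup [M] of all [(x, y)] with [b^y (a^-1
    b) a^x = a^-1 b], also when [a] and [b] do not commute. If [M] has rank at
    most 1, it is killed by a nonzero linear form, and reading the values of
    that form at the leaves from one end determines the tree, so [sim M] is
    equality. Conversely [L] is realized by the two unit shifts of the
    [L]-periodic functions on the lattice. Finally, for [L] of rank 2
    containing [(N, 0)] and [(0, N)], and for [(x, y)] in [L] with [x, y >=
    0], an explicit pair of trees in [sim L] has [(-N, 0)], [(0, N)] and [(x,
    y)] among its depth differences, so that [sim L] determines [L]. *)
From HB Require Import structures.
From mathcomp Require Import all_boot all_order all_algebra.
From mathcomp Require Import boolp classical_sets functions.
From mathcomp Require Import zify ring.
Require Import Defs.

Set Implicit Arguments.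
Unset Strict Implicit.
Unset Printing Implicit Defensive.

Import Order.TTheory GRing.Theory Num.Theory.
Local Open Scope classical_set_scope.
Local Open Scope ring_scope.

Implicit Types (L M : set (int * int)) (T : btree) (z : int * int).

Ltac int2 := apply: injective_projections => /=; lia.

(** * Depth sequences *)

Fixpoint depths z T : seq (int * int) :=
  if T is Node l r then depths (z + (1, 0)) l ++ depths (z + (0, 1)) r
  else [:: z].

Lemma size_depths T z : size (depths z T) = leaves T.
Proof. by elim: T z => //= l IHl r IHr z; rewrite size_cat IHl IHr. Qed.

Lemma nth_depths T z i : (i < leaves T)%N ->
  nth 0 (depths z T) i = z + ((ld T i.+1)%:Z, (rd T i.+1)%:Z).
Proof.
elim: T z i => [|l IHl r IHr] z i /=.
  by case: i => //= _; rewrite addr0.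
move=> lti; rewrite nth_cat size_depths; case: ltnP => [lt_il|le_li].
  by rewrite IHl //; int2.
by rewrite IHr ?ltn_subLR // subSn //; int2.
Qed.

(** Congruence modulo [L] is put on sequences, not on trees, so that two depth sequences can be
    compared block by block even where the trees have different shapes. *)
Definition lcong L (s t : seq (int * int)) : Prop :=
  size s = size t /\
  forall i, (i < size s)%N -> L (nth 0 s i - nth 0 t i).

Lemma simE L T T' : sim L (T, T') <-> lcong L (depths 0 T) (depths 0 T').
Proof.
rewrite /sim /lcong /= !size_depths; split=> -[eqT LT]; split=> //.
  move=> i lti; rewrite !nth_depths -?eqT // !add0r; exact: LT i.+1 lti.
by case=> // i lti; have := LT i lti; rewrite !nth_depths -?eqT // !add0r.
Qed.

Lemma lcong_cat L s1 s2 t1 t2 : size s1 = size t1 ->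
  lcong L (s1 ++ s2) (t1 ++ t2) <-> lcong L s1 t1 /\ lcong L s2 t2.
Proof.
move=> eq1; rewrite /lcong !size_cat; split.
  move=> [/eqP]; rewrite eq1 eqn_add2l => /eqP eq2 L12; split; split=> // i lti.
    have := L12 i; rewrite !nth_cat eq1 lti; apply.
    by rewrite ltn_addr // -eq1.
  have ge_i : (size t1 + i < size t1)%N = false by rewrite ltnNge leq_addr.
  have := L12 (size t1 + i)%N; rewrite !nth_cat eq1 ge_i addKn.
  by apply; rewrite ltn_add2l.
move=> [[_ L1] [eq2 L2]]; split; first by rewrite eq1 eq2.
move=> i lti; rewrite !nth_cat eq1; case: ltnP => [lt_i|le_i].
  by apply: L1; rewrite eq1.
by apply: L2; rewrite ltn_subLR // -eq1.
Qed.

Lemma lcong_cons L u v s t :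
  lcong L (u :: s) (v :: t) <-> L (u - v) /\ lcong L s t.
Proof.
rewrite -[u :: s]cat1s -[v :: t]cat1s lcong_cat //.
split=> -[Luv ?]; split=> //; first by case: Luv => _ /(_ 0%N isT).
by split=> // -[].
Qed.

Lemma lcong_mkseq L f g n :
  lcong L (mkseq f n) (mkseq g n) <->
  forall i, (i < n)%N -> L (f i - g i).
Proof.
rewrite /lcong !size_mkseq; split=> [[_ Lfg] i lti|Lfg].
  by have := Lfg i lti; rewrite !nth_mkseq.
by split=> // i lti; rewrite !nth_mkseq //; apply: Lfg.
Qed.

(** * Trees are determined by a weighted depth sequence *)

Lemma depths_head T z :
  exists k s, depths z T = (z + (k%:Z, 0)) :: s /\ (T <> Leaf -> (0 < k)%N).
Proof.
elim: T z => [|l IHl r _] z /=; first by exists 0%N, [::]; rewrite addr0; split.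
have [k [s [-> _]]] := IHl (z + (1, 0)).
exists k.+1, (s ++ depths (z + (0, 1)) r); split=> //=.
by congr cons; int2.
Qed.

Lemma depths_last T z :
  exists k s, depths z T = rcons s (z + (0, k%:Z)) /\ (T <> Leaf -> (0 < k)%N).
Proof.
elim: T z => [|l _ r IHr] z /=; first by exists 0%N, [::]; rewrite addr0; split.
have [k [s [-> _]]] := IHr (z + (0, 1)).
exists k.+1, (depths (z + (1, 0)) l ++ s); split=> //=.
by rewrite rcons_cat; congr (_ ++ rcons _ _); int2.
Qed.

Section WeightedDepth.
Variables p q : int.

Definition weight z : int := p * z.1 + q * z.2.

Lemma weightD : {morph weight : u v / u + v}.
Proof. by move=> [? ?] [? ?]; rewrite /weight /=; ring. Qed.

Lemma weightB : {morph weight : u v / u - v}.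
Proof. by move=> [? ?] [? ?]; rewrite /weight /=; ring. Qed.

(** A prefix-code argument: the first leaf below a proper node lies [k > 0] left steps down, so its
    weight differs from that of the root by [p * k], which is not 0. The first value thus tells a
    leaf from a node; the tails [s] and [s'] let the induction pass from the left subtree to the
    right one. *)
Lemma weight_prefix T T' z z' s s' : p != 0 -> weight z = weight z' ->
  map weight (depths z T) ++ s = map weight (depths z' T') ++ s' ->
  T = T' /\ s = s'.
Proof.
move=> p0; elim: T T' z z' s s' => [|l IHl r IHr] [|l' r'] z z' s s' eqz.
- by move=> [].
- have [k [t [-> k0]]] := depths_head (Node l' r') z'.
  rewrite /= weightD -eqz => -[/eqP]; rewrite -subr_eq0 opprD addNKr oppr_eq0.
  by rewrite /weight /= mulr0 addr0 mulf_eq0 (negPf p0) eqz_nat eqn0Ngt k0.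
- have [k [t [-> k0]]] := depths_head (Node l r) z.
  rewrite /= weightD eqz => -[/eqP]; rewrite -subr_eq0 addrAC subrr add0r.
  by rewrite /weight /= mulr0 addr0 mulf_eq0 (negPf p0) eqz_nat eqn0Ngt k0.
rewrite /= !map_cat -!catA => /IHl[]; first by rewrite !weightD eqz.
by move=> -> /IHr[]; [rewrite !weightD eqz|move=> -> ->].
Qed.

(** The mirror image, read from the last leaf; it covers forms with [p = 0]. *)
Lemma weight_suffix T T' z z' s s' : q != 0 -> weight z = weight z' ->
  s ++ map weight (depths z T) = s' ++ map weight (depths z' T') ->
  s = s' /\ T = T'.
Proof.
move=> q0; elim: T T' z z' s s' => [|l IHl r IHr] [|l' r'] z z' s s' eqz.
- by rewrite /= !cats1 => /rcons_inj[-> _].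
- have [k [t [-> k0]]] := depths_last (Node l' r') z'.
  rewrite map_rcons -rcons_cat /= cats1 => /rcons_inj[_ /eqP].
  rewrite weightD -eqz -subr_eq0 opprD addNKr oppr_eq0.
  by rewrite /weight /= mulr0 add0r mulf_eq0 (negPf q0) eqz_nat eqn0Ngt k0.
- have [k [t [-> k0]]] := depths_last (Node l r) z.
  rewrite map_rcons -rcons_cat /= cats1 => /rcons_inj[_ /eqP].
  rewrite weightD eqz -subr_eq0 addrAC subrr add0r.
  by rewrite /weight /= mulr0 add0r mulf_eq0 (negPf q0) eqz_nat eqn0Ngt k0.
rewrite /= !map_cat !catA => /IHr[]; first by rewrite !weightD eqz.
by move=> /IHl[]; [rewrite !weightD eqz|move=> -> -> ->].
Qed.

Lemma sim_weight0 L T T' : (p != 0) || (q != 0) ->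
  (forall u, L u -> weight u = 0) -> sim L (T, T') -> T = T'.
Proof.
move=> pq0 L0 /simE[eqs LT].
have eqw : map weight (depths 0 T) = map weight (depths 0 T').
  apply: (@eq_from_nth _ 0); first by rewrite !size_map.
  move=> i; rewrite size_map => lti; rewrite !(nth_map 0) -?eqs //.
  by have /L0/eqP := LT i lti; rewrite weightB subr_eq0 => /eqP.
case/orP: pq0 => ?.
  by have [] := @weight_prefix T T' 0 0 [::] [::]; rewrite ?eqw.
by have [] := @weight_suffix T T' 0 0 [::] [::]; rewrite ?eqw.
Qed.

End WeightedDepth.

(** * Realizing differences of leaf depths *)

Definition lcomb n T := iter n (fun t => Node t Leaf) T.
Definition rcomb n T := iter n (Node Leaf) T.

Lemma depths_lcomb n T z :
  depths z (lcomb n T) = depths (z + (n%:Z, 0)) T ++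
    mkseq (fun i => z + (n%:Z - i.+1%:Z, 1)) n.
Proof.
elim: n z => [|n IHn] z; first by rewrite /= addr0 cats0.
rewrite [lcomb _ _]/= [LHS]/= IHn -catA; congr (depths _ _ ++ _).
  by int2.
rewrite cats1 mkseqS; congr rcons; last by int2.
by apply: eq_mkseq => i; int2.
Qed.

Lemma depths_rcomb n T z :
  depths z (rcomb n T) = mkseq (fun i => z + (1, i%:Z)) n ++
    depths (z + (0, n%:Z)) T.
Proof.
elim: n T => [|n IHn] T; first by rewrite /= addr0.
rewrite /rcomb iterSr -/(rcomb _ _) IHn mkseqS -cats1 -catA /=.
congr (_ ++ _ :: depths _ _).
  by int2.
by int2.
Qed.

Section Witness.
Variables n x y : nat.

(* The two trees were found by reading leaves from left to right while keeping
   the depths congruent modulo [n.+1] except on one block of leaves, on which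
   they differ by [(x, y)]. *)
Definition witness1 :=
  Node (lcomb n (Node Leaf (lcomb x (rcomb n
         (Node (rcomb y (rcomb n.+1 Leaf)) Leaf)))))
       (lcomb x Leaf).

Definition witness2 :=
  Node Leaf (lcomb x (rcomb n
    (Node (rcomb y (lcomb n (Node (rcomb n.+1 Leaf) (lcomb x Leaf)))) Leaf))).

Lemma lcong_witness L :
  ([/\ L 0, L (- n.+1%:Z, 0), L (0, n.+1%:Z), L (x%:Z, y%:Z)
     & L (x%:Z, y%:Z + n.+1%:Z)] ->
   lcong L (depths 0 witness2) (depths 0 witness1)) /\
  (lcong L (depths 0 witness2) (depths 0 witness1) ->
   [/\ L (- n.+1%:Z, 0), L (0, n.+1%:Z) & L (x%:Z, y%:Z)]).
Proof.
rewrite /witness1 /witness2 /=.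
do ![rewrite (depths_lcomb, depths_rcomb) /=].
do ![rewrite -catA | rewrite cat_cons]; rewrite !cat0s.
rewrite lcong_cons lcong_cat ?size_mkseq // lcong_cat ?size_mkseq //.
rewrite lcong_cons lcong_cat ?size_mkseq // !lcong_cons.
rewrite lcong_cat ?size_mkseq // lcong_cat ?size_mkseq // lcong_cons.
rewrite !lcong_mkseq; split.
  move=> [L0 LN L1 L2 L3]; do ?split; move=> *;
    first [ by apply: (eq_ind _ L L0); int2
    | by apply: (eq_ind _ L LN); int2
    | by apply: (eq_ind _ L L1); int2
    | by apply: (eq_ind _ L L2); int2
    | by apply: (eq_ind _ L L3); int2 ].
(* These three come from single leaves, which exist even when [n], [x] and [y] are 0 and the blocks
   between them are empty. *)
move=> [LN [_ [_ [_ [_ [_ [L2 [_ [_ [L1 _]]]]]]]]]].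
by split; [apply: (eq_ind _ L LN)|apply: (eq_ind _ L L1)
  |apply: (eq_ind _ L L2)]; int2.
Qed.

End Witness.

(** * Subgroups of the integer lattice *)

Section SubgroupTheory.
Variable L : set (int * int).
Hypothesis subL : subgroup L.

Lemma subgroup0 : L 0. Proof. by case: subL. Qed.

Lemma subgroupB u v : L u -> L v -> L (u - v).
Proof. by case: subL => _; apply. Qed.

Lemma subgroupN u : L u -> L (- u).
Proof.
by move=> Lu; rewrite -sub0r; apply: subgroupB => //; apply: subgroup0.
Qed.

Lemma subgroupD u v : L u -> L v -> L (u + v).
Proof. by move=> Lu Lv; rewrite -[v]opprK; apply/subgroupB/subgroupN. Qed.

Lemma subgroupMz u a : L u -> L (u *~ a).
Proof.
move=> Lu; case: (intP a) => [|n|n]; first by rewrite mulr0z; apply: subgroup0.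
  by elim: n => [//|n IHn]; rewrite intS mulrzDr; apply: subgroupD.
rewrite mulrNz; apply: subgroupN.
by elim: n => [//|n IHn]; rewrite intS mulrzDr; apply: subgroupD.
Qed.

End SubgroupTheory.

Lemma mulrz_pair z (a : int) : z *~ a = (z.1 * a, z.2 * a).
Proof.
have h (u : int * int) : u *~ a = (u.1 *~ a, u.2 *~ a).
  by apply: injective_projections; rewrite ?(raddfMz fst) ?(raddfMz snd).
by rewrite h !mulrzz.
Qed.

Lemma subgroupI L M : subgroup L -> subgroup M -> subgroup (L `&` M).
Proof.
move=> [L0 LB] [M0 MB]; split=> // u v [Lu Mu] [Lv Mv].
by split; [apply: LB|apply: MB].
Qed.

Lemma smallest_subgroup (X : set (int * int)) : subgroup (smallest subgroup X).
Proof.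
split=> [A [[A0 _] _] //|u v Xu Xv A [sA XA]].
by apply: (subgroupB sA); [apply: Xu|apply: Xv].
Qed.

(** Euclidean division by the least positive element; [d = 0] if there is none. *)
Lemma subgroup_int_principal (S : set int) :
  S 0 -> (forall a b, S a -> S b -> S (a - b)) ->
  exists2 d, S d & forall a, S a -> exists k, a = d * k.
Proof.
move=> S0 SB.
have SN a : S a -> S (- a) by move=> Sa; rewrite -sub0r; apply: SB.
have SMn a n : S a -> S (a * n%:Z).
  move=> Sa; elim: n => [|n IHn]; first by rewrite mulr0.
  by rewrite intS mulrDr mulr1 -[a * n%:Z]opprK; apply: SB => //; apply: SN.
have SM a b : S a -> S (a * b).
  by move=> Sa; case: b => n; rewrite ?NegzE ?mulrN; [|apply: SN]; apply: SMn.
have [[a [Sa a0]]|S_0] := pselect (exists a, S a /\ a <> 0); last first.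
  exists 0 => // a Sa; exists 0; rewrite mulr0.
  by apply: contrapT => a0; apply: S_0; exists a.
have exP : exists n : nat, `[< (0 < n)%N /\ S n%:Z >].
  exists `|a|%N; apply/asboolP; split; first by rewrite absz_gt0; apply/eqP.
  by rewrite abszE; case: (ger0P a) => // _; apply: SN.
case: (ex_minnP exP) => d /asboolP[d0 Sd] min_d; exists d%:Z => // b Sb.
exists (b %/ d%:Z)%Z; rewrite {1}(divz_eq b d%:Z) mulrC.
suff -> : (b %% d%:Z)%Z = 0 by rewrite addr0.
have Sr : S (b %% d%:Z)%Z by rewrite /modz mulrC; apply: SB => //; apply: SM.
have r0 : 0 <= (b %% d%:Z)%Z by rewrite modz_ge0 // eqz_nat -lt0n.
have rd : (b %% d%:Z)%Z < d%:Z by rewrite ltz_pmod.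
case: (b %% d%:Z)%Z Sr r0 rd => // -[//|r] Sr _ rd.
have := min_d r.+1 (introT (asboolP _) (conj isT Sr)).
by rewrite leqNgt -ltz_nat rd.
Qed.

Lemma Sub2_subgroup L : Sub2 L -> subgroup L.
Proof. by move=> [u [v [_ ->]]]; apply: smallest_subgroup. Qed.

(** Cramer's rule: the determinant [D] of the generators times either unit vector is an integer
    combination of them. *)
Lemma Sub2_scalar L : Sub2 L ->
  exists n : nat, L (n.+1%:Z, 0) /\ L (0, n.+1%:Z).
Proof.
move=> sL; have subL := Sub2_subgroup sL; case: sL => u [v [indep LE]].
have Lu : L u by rewrite LE; apply: sub_gen_smallest; left.
have Lv : L v by rewrite LE; apply: sub_gen_smallest; right.
set D := u.1 * v.2 - u.2 * v.1.
have D0 : D != 0.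
  apply/eqP => D0.
  (* If [D = 0], the Cramer combinations vanish, so independence makes all coordinates 0, and then
     [u = 0] is itself a forbidden relation. *)
  have [|v2 u2] := indep v.2 (- u.2).
    by rewrite /D in D0; rewrite !mulrz_pair; int2.
  have [|v1 u1] := indep v.1 (- u.1).
    by rewrite /D in D0; rewrite !mulrz_pair; int2.
  have [] := indep 1 0; last by [].
  by rewrite !mulrz_pair; int2.
have LD1 : L (D, 0).
  have -> : (D, 0) = u *~ v.2 - v *~ u.2.
    by rewrite !mulrz_pair /D; int2.
  by apply: subgroupB => //; apply: subgroupMz.
have LD2 : L (0, D).
  have -> : (0, D) = v *~ u.1 - u *~ v.1.
    by rewrite !mulrz_pair /D; int2.
  by apply: subgroupB => //; apply: subgroupMz.
clearbody D; case: D D0 LD1 LD2 => [[//|n]|n] _ LD1 LD2; exists n => //.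
by rewrite -[(_, 0)]opprK -[(0, _)]opprK; split; apply: subgroupN.
Qed.

(** Hermite normal form: [d] generates the projection to the second coordinate and [e] the
    intersection with the first axis, so [(e, 0)] and [(x0, d)] generate [L]. They are independent
    unless [d] or [e] is 0, and then a linear form kills [L]. *)
Lemma subgroup_dichotomy L : subgroup L ->
  Sub2 L \/
  exists p q : int, (p != 0) || (q != 0) /\ forall u, L u -> weight p q u = 0.
Proof.
move=> subL; have L0 := subgroup0 subL.
have [|a b [x Lx] [y Ly]|d [x0 Ld] dP] :=
  @subgroup_int_principal [set b | exists a, L (a, b)]; first by exists 0.
  by exists (x - y); apply: (subgroupB subL Lx Ly).
have [//|a b La Lb|e Le eP] := @subgroup_int_principal [set a | L (a, 0)].
  by have := subgroupB subL La Lb; rewrite /= -[0 in X in L (X - _)]subr0.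
have LP u : L u -> exists j k, u = (e, 0) *~ j + (x0, d) *~ k.
  case: u => a b Lu; have [|k bE] := dP b; first by exists a.
  have [|j aE] := eP (a - x0 * k).
    rewrite /= -(_ : (a, b) - (x0, d) *~ k = (a - x0 * k, 0)).
      by apply: subgroupB => //; apply: subgroupMz.
    by rewrite mulrz_pair bE; int2.
  by exists j, k; rewrite !mulrz_pair; apply: injective_projections => /=; lia.
have [d0|d0] := eqVneq d 0.
  right; exists 0, 1; split=> // u /LP[j [k ->]].
  by rewrite !mulrz_pair d0 /weight /=; lia.
have [e0|e0] := eqVneq e 0.
  right; exists d, (- x0); split=> [|u /LP[j [k ->]]]; first by rewrite d0.
  by rewrite !mulrz_pair e0 /weight /=; ring.
left; exists (e, 0), (x0, d); split.
  move=> a b; rewrite !mulrz_pair => -[/= /eqP h1 /eqP].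
  rewrite mul0r add0r mulf_eq0 (negPf d0) => /= /eqP b0; move: h1.
  by rewrite b0 mulr0 addr0 mulf_eq0 (negPf e0) => /eqP.
apply/seteqP; split=> [u /LP[j [k ->]]|].
  have sS := smallest_subgroup [set (e, 0); (x0, d)].
  by apply: (subgroupD sS); apply: (subgroupMz sS); apply: sub_gen_smallest;
    [left|right].
by apply: smallest_sub => // u [|] ->.
Qed.

Lemma Sub2_of_scalar L n : subgroup L ->
  L (n.+1%:Z, 0) -> L (0, n.+1%:Z) -> Sub2 L.
Proof.
move=> /subgroup_dichotomy[//|[p [q [pq0 Lw]]]] /Lw + /Lw.
rewrite /weight /= !mulr0 addr0 add0r => /eqP + /eqP.
by rewrite !mulf_eq0 !orbF => /eqP p0 /eqP q0; rewrite p0 q0 in pq0.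
Qed.

Lemma Sub2_0_subgroup L : Sub2_0 L -> subgroup L.
Proof.
case=> [/Sub2_subgroup //|->]; split=> // u v -> ->; exact: subrr.
Qed.

Lemma Sub2_smallestU L M : Sub2 L -> Sub2 (smallest subgroup (L `|` M)).
Proof.
move=> /Sub2_scalar[n [Ln1 Ln2]].
by apply: (@Sub2_of_scalar _ n (smallest_subgroup _));
  apply: sub_gen_smallest; left.
Qed.

Lemma Sub2_0_smallestU L M :
  Sub2_0 L -> Sub2_0 M -> Sub2_0 (smallest subgroup (L `|` M)).
Proof.
move=> [sL _|->]; first by left; apply: Sub2_smallestU.
move=> [sM|->]; first by left; rewrite setUC; apply: Sub2_smallestU.
right; rewrite setUid; apply: smallest_id.
by apply: Sub2_0_subgroup; right.
Qed.

Lemma Sub2_0I L M : Sub2_0 L -> Sub2_0 M -> Sub2_0 (L `&` M).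
Proof.
have set0I (A : set (int * int)) : subgroup A -> [set 0] `&` A = [set 0].
  by move=> [A0 _]; apply/seteqP; split=> [u []|u ->].
move=> sL sM; have subL := Sub2_0_subgroup sL; have subM := Sub2_0_subgroup sM.
case: sL => [sL|->]; last by right; rewrite /= set0I.
case: sM => [sM|->]; last by right; rewrite /= setIC set0I.
have [m [Lm1 Lm2]] := Sub2_scalar sL; have [n [Mn1 Mn2]] := Sub2_scalar sM.
(* A common multiple of both scalars; the predecessor fits the successor in [Sub2_of_scalar]. *)
left; apply: (@Sub2_of_scalar _ (m.+1 * n.+1).-1 (subgroupI subL subM)).
all: rewrite prednK ?muln_gt0 //.
  split.
    have := subgroupMz subL n.+1 Lm1; rewrite mulrz_pair /= mul0r; exact.
  have := subgroupMz subM m.+1 Mn1; rewrite mulrz_pair /= mul0r mulrC; exact.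
split.
  have := subgroupMz subL n.+1 Lm2; rewrite mulrz_pair /= mul0r; exact.
have := subgroupMz subM m.+1 Mn2; rewrite mulrz_pair /= mul0r mulrC; exact.
Qed.

(** * Order properties of [sim] *)

Lemma sim_set0 : sim [set 0] = [set p | p.1 = p.2].
Proof.
apply/seteqP; split=> -[T T'] /=.
  apply: (@sim_weight0 1 0) => // u ->; by rewrite /weight /= !mulr0.
by move=> ->; split=> // i _; rewrite !subrr.
Qed.

Lemma simS L M : L `<=` M -> sim L `<=` sim M.
Proof. by move=> LM [T T'] [eqT LT]; split=> // i /LT /LM. Qed.

Lemma simI L M : sim (L `&` M) = sim L `&` sim M.
Proof.
apply/seteqP; split=> [p LM|p [[eqp Lp] [_ Mp]]].
  by split; apply: simS LM => u [].
by split=> // i ip; split; [apply: Lp|apply: Mp].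
Qed.

(** The witness pair lies in [sim L], hence in [sim M], which forces its depth differences into
    [M]. *)
Lemma sim_reflects_sub L M :
  Sub2_0 L -> Sub2_0 M -> sim L `<=` sim M -> L `<=` M.
Proof.
move=> sL /Sub2_0_subgroup subM LM; have subL := Sub2_0_subgroup sL.
case: sL => [sL|->]; last by move=> u ->; apply: subgroup0.
have [n [Ln1 Ln2]] := Sub2_scalar sL.
have inM (x y : nat) : L (x%:Z, y%:Z) ->
    [/\ M (- n.+1%:Z, 0), M (0, n.+1%:Z) & M (x%:Z, y%:Z)].
  move=> Lxy; have [_] := lcong_witness n x y M; apply; apply/simE/LM/simE.
  have [+ _] := lcong_witness n x y L; apply; split=> //.
  - exact: subgroup0.
  - by have := subgroupN subL Ln1.
  - by have H := subgroupD subL Lxy Ln2; apply: (eq_ind _ L H); int2.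
have [Mn1 Mn2 _] := inM 0%N 0%N (subgroup0 subL).
(* Witnesses exist only for nonnegative vectors: adding [k] times [(n.+1, n.+1)], which lies in both
   [L] and [M], makes both coordinates nonnegative. *)
case=> x y Lxy; pose k := (`|x| + `|y|)%N.
have Lshift : L (x + k%:Z * n.+1%:Z, y + k%:Z * n.+1%:Z).
  have := subgroupD subL (subgroupD subL Lxy (subgroupMz subL k%:Z Ln1))
    (subgroupMz subL k%:Z Ln2).
  by rewrite !mulrz_pair => H; apply: (eq_ind _ L H); int2.
have [x' x'E] : exists x' : nat, x'%:Z = x + k%:Z * n.+1%:Z.
  exists (absz (x + k%:Z * n.+1%:Z)%R); rewrite gez0_abs // /k; nia.
have [y' y'E] : exists y' : nat, y'%:Z = y + k%:Z * n.+1%:Z.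
  exists (absz (y + k%:Z * n.+1%:Z)%R); rewrite gez0_abs // /k; nia.
rewrite -x'E -y'E in Lshift; have [_ _ Mxy] := inM _ _ Lshift.
have := subgroupB subM (subgroupD subM Mxy (subgroupMz subM k%:Z Mn1))
  (subgroupMz subM k%:Z Mn2).
by rewrite x'E y'E !mulrz_pair => H; apply: (eq_ind _ M H); int2.
Qed.

(** * Fine spectra of linear quasigroups *)

Section IntegerIterates.
Variables (X : Type) (f g : X -> X).
Hypotheses (fK : cancel f g) (gK : cancel g f).

Definition ziter (n : int) : X -> X :=
  match n with Posz m => iter m f | Negz m => iter m.+1 g end.

Lemma ziterS n x : ziter (n + 1) x = f (ziter n x).
Proof.
case: n => [n|[|n]]; first by rewrite -PoszD addn1.
  by rewrite /= gK.
by rewrite (_ : Negz n.+1 + 1 = Negz n) ?NegzE /= ?gK //; lia.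
Qed.

(** Since [f] is invertible, the recurrence determines [F] in both directions from its value at
    0. *)
Lemma ziter_unique (F : int -> X) :
  (forall n, F (n + 1) = f (F n)) -> forall n, F n = ziter n (F 0).
Proof.
move=> FS n; case: (intP n) => [//|m|m].
  by elim: m => [|m IHm]; rewrite intS addrC ziterS FS ?IHm.
elim: m => [|m IHm]; apply: (can_inj fK); rewrite -ziterS -FS ?addNr //.
by rewrite (_ : - m.+2%:Z + 1 = - m.+1%:Z) //; lia.
Qed.

Lemma ziterD m n x : ziter (m + n) x = ziter m (ziter n x).
Proof.
rewrite (@ziter_unique (fun k => ziter (k + n) x)) ?add0r // => k.
by rewrite -ziterS addrAC.
Qed.

Lemma ziterNK n x : ziter n (ziter (- n) x) = x.
Proof. by rewrite -ziterD subrr. Qed.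

Lemma ziterKN n x : ziter (- n) (ziter n x) = x.
Proof. by rewrite -ziterD addNr. Qed.

End IntegerIterates.

(** * Addresses of leaves and their quotients *)

Section Addresses.
Variable X : Type.
Implicit Types (u f : X -> X) (d : int * int).

Section AddressLists.
Variables a b : X -> X.

Fixpoint addresses u T : seq (X -> X) :=
  if T is Node l r then addresses (u \o a) l ++ addresses (u \o b) r
  else [:: u].

(** Addresses paired with depths, so that a relation between neighbouring leaves can involve
    both. *)
Fixpoint labels u d T : seq ((X -> X) * (int * int)) :=
  if T is Node l r then
    labels (u \o a) (d + (1, 0)) l ++ labels (u \o b) (d + (0, 1)) r
  else [:: (u, d)].

Lemma size_addresses u T : size (addresses u T) = leaves T.
Proof. by elim: T u => //= l IHl r IHr u; rewrite size_cat IHl IHr. Qed.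

Lemma labels_fst u d T : map fst (labels u d T) = addresses u T.
Proof. by elim: T u d => //= l IHl r IHr u d; rewrite map_cat IHl IHr. Qed.

Lemma labels_snd u d T : map snd (labels u d T) = depths d T.
Proof. by elim: T u d => //= l IHl r IHr u d; rewrite map_cat IHl IHr. Qed.

Lemma labels_last u d T : exists k : nat,
  forall p, last p (labels u d T) = (u \o iter k b, d + (0, k%:Z)).
Proof.
elim: T u d => [|l _ r IHr] u d; first by exists 0%N => z /=; rewrite addr0.
have [k last_k] := IHr (u \o b) (d + (0, 1)).
by exists k.+1 => p; rewrite /= last_cat last_k; congr pair; int2.
Qed.

End AddressLists.

Variables a a' b b' : X -> X.
Hypotheses (aK : cancel a a') (a'K : cancel a' a).
Hypotheses (bK : cancel b b') (b'K : cancel b' b).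

Local Notation A := (ziter a a').
Local Notation B := (ziter b b').
Local Notation c := (a' \o b).

(** Composing with powers of [b] on the left and of [a] on the right gives commuting actions, hence
    an action of the integer lattice on maps; this is the stabilizer of [c]. *)
Definition stab : set (int * int) :=
  [set z | forall x, B z.2 (c (A z.1 x)) = c x].

Lemma stab_subgroup : subgroup stab.
Proof.
split=> [//|u v su sv x]; rewrite (ziterD aK a'K) addrC (ziterD bK b'K) su.
have := sv (A (- v.1) x); rewrite (ziterNK aK a'K) => <-.
by rewrite (ziterKN bK b'K).
Qed.

Lemma stab_diff i j k l :
  (forall x, B k (c (A i x)) = B l (c (A j x))) <-> stab (i - j, k - l).
Proof.
split=> [eqx x|sx x] /=.
  rewrite addrC (ziterD bK b'K) (ziterD aK a'K) eqx.
  by rewrite (ziterNK aK a'K) (ziterKN bK b'K).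
have := sx (A j x); rewrite /= -(ziterD aK a'K) subrK => <-.
by rewrite -(ziterD bK b'K) addrC subrK.
Qed.

(* Two consecutive leaves have addresses [u a b^r] and [u b a^s], so the second
   address is the first one times [b^(-r) (a^(-1) b) a^s], and [r] and [s] are
   read off the differences of the depths. *)
Definition adj (p q : (X -> X) * (int * int)) : bool :=
  `[< forall x, q.1 x =
        p.1 (B (q.2.2 - p.2.2 - 1) (c (A (q.2.1 - p.2.1 + 1) x))) >].

(** The left depth of the first leaf of [T] is not known in advance, so [p] has to be adjacent to
    every candidate. *)
Lemma path_labels p u d T :
  (forall k : nat, adj p (u \o iter k a, d + (k%:Z, 0))) ->
  path adj p (labels a b u d T).
Proof.
elim: T p u d => [|l IHl r IHr] p u d adj_p /=.
  by rewrite andbT; have := adj_p 0%N; rewrite addr0.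
rewrite cat_path; apply/andP; split.
  apply: IHl => k; have := adj_p k.+1.
  by rewrite (_ : d + (k.+1%:Z, 0) = d + (1, 0) + (k%:Z, 0)) //; int2.
(* At the seam the last leaf on the left has address [u a b^k] and the first on the right [u b a^j],
   so the exponents in [adj] are [-k] and [j]. *)
have [k ->] := labels_last a b (u \o a) (d + (1, 0)) l.
apply: IHr => j; apply/asboolP => x /=.
rewrite (_ : _ - _ - 1 = - k%:Z); last by lia.
rewrite (_ : _ - _ + 1 = j%:Z); last by lia.
by rewrite -[iter k b _]/(B k%:Z _) (ziterNK bK b'K) a'K.
Qed.

(** Induction along both lists: after a common injective address [f], the next addresses agree iff
    the depth increments are congruent modulo [stab], that is, iff the next depths are. *)
Lemma path_adj_sync s s' f d d' : path adj (f, d) s -> path adj (f, d') s' ->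
  size s = size s' -> injective f -> stab (d - d') ->
  map fst s = map fst s' <-> lcong stab (map snd s) (map snd s').
Proof.
elim: s s' f d d' => [|[g e] s IHs] [|[g' e'] s'] f d d' //=.
move=> /andP[/asboolP /= gE ps] /andP[/asboolP /= g'E ps'] [eqs] f_inj sd.
have eq_g : g = g' <-> stab (e - e').
  have eq_diff : (e.1 - d.1 + 1 - (e'.1 - d'.1 + 1),
                  e.2 - d.2 - 1 - (e'.2 - d'.2 - 1)) = e - e' - (d - d').
    by int2.
  split=> [eqg|se].
    rewrite -[e - e'](subrK (d - d')); apply: (subgroupD stab_subgroup) => //.
    rewrite -eq_diff; apply/stab_diff => x; apply: f_inj.
    by rewrite -gE -g'E eqg.
  apply/funext => x; rewrite gE g'E; congr f; move: x; apply/stab_diff.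
  by rewrite eq_diff; apply: (subgroupB stab_subgroup).
have g_inj : injective g.
  move=> x y; rewrite !gE => /f_inj/(can_inj (ziterKN bK b'K _))/(can_inj a'K).
  by move=> /(can_inj bK)/(can_inj (ziterKN aK a'K _)).
rewrite lcong_cons; split.
  move=> [eqg eqss]; subst g'; have se := eq_g.1 erefl; split=> //.
  exact/(IHs _ _ _ _ ps ps' eqs g_inj se).
move=> [se ss]; have eqg := eq_g.2 se; subst g'; congr cons.
exact/(IHs _ _ _ _ ps ps' eqs g_inj se).
Qed.

Lemma addresses_eq T T' : leaves T = leaves T' ->
  addresses a b id T = addresses a b id T' <->
  lcong stab (depths 0 T) (depths 0 T').
Proof.
move=> eqT; rewrite -!(labels_fst _ _ _ 0) -(labels_snd a b id 0).
rewrite -(labels_snd a b id 0 T').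
(* The virtual predecessor of the leftmost leaf, whatever the left depth. *)
have start k : adj (b' \o a, (1, -1)) (id \o iter k a, 0 + (k%:Z, 0)).
  apply/asboolP => x /=; rewrite (_ : 0 + k%:Z - 1 + 1 = k%:Z); last by lia.
  by rewrite a'K bK.
apply: (path_adj_sync (path_labels T start) (path_labels T' start)).
- by rewrite -!(size_map fst) !labels_fst !size_addresses.
- exact: inj_comp (can_inj b'K) (can_inj aK).
- by rewrite subrr; apply: (subgroup0 stab_subgroup).
Qed.

End Addresses.

(** * Evaluation of bracketings in a linear quasigroup *)

Section LinearQuasigroups.
Local Open Scope group_scope.
Variables (G : groupType) (a b : G -> G).
Hypotheses (aM : {morph a : x y / x * y}) (bM : {morph b : x y / x * y}).
Local Notation op := (fun x y => a x * b y).
Implicit Type s : seq (G -> G).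

Fixpoint ordered_prod (v : nat -> G) k s : G :=
  if s is f :: s' then f (v k) * ordered_prod v k.+1 s' else 1.

Lemma ordered_prod_cat v k s t :
  ordered_prod v k (s ++ t) =
  ordered_prod v k s * ordered_prod v (k + size s)%N t.
Proof.
elim: s k => [|f s IHs] k /=; first by rewrite mul1g addn0.
by rewrite IHs mulgA addnS.
Qed.

Lemma eval_bracketing v k (u : G -> G) T : {morph u : x y / x * y} ->
  u (eval op v (bracketing_from k T)) = ordered_prod v k (addresses a b u T).
Proof.
elim: T k u => [|l IHl r IHr] k u uM /=; first by rewrite mulg1.
have uaM : {morph u \o a : x y / x * y} by move=> x y; rewrite /= aM uM.
have ubM : {morph u \o b : x y / x * y} by move=> x y; rewrite /= bM uM.
by rewrite uM ordered_prod_cat size_addresses -(IHl _ _ uaM) -(IHr _ _ ubM).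
Qed.

Lemma morph_mulg1 (u : G -> G) : {morph u : x y / x * y} -> u 1 = 1.
Proof. by move=> uM; apply: (mulgI (u 1)); rewrite -uM !mulg1. Qed.

Lemma nth_addresses1 u T i : {morph u : x y / x * y} ->
  nth id (addresses a b u T) i 1 = 1.
Proof.
elim: T u i => [|l IHl r IHr] u i uM /=.
  by case: i => [|i]; rewrite /= ?nth_nil ?(morph_mulg1 uM).
rewrite nth_cat; case: ifP => _.
  by apply: IHl => x y; rewrite /= aM uM.
by apply: IHr => x y; rewrite /= bM uM.
Qed.

Lemma ordered_prod_single s k i (g : G) : (forall j, nth id s j 1 = 1) ->
  (i < size s)%N ->
  ordered_prod (fun j => if j == (k + i)%N then g else 1) k s = nth id s i g.
Proof.
have prod1 v s' k' : (forall j, nth id s' j 1 = 1) ->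
    (forall j, (k' <= j)%N -> v j = 1) -> ordered_prod v k' s' = 1.
  elim: s' k' => [//|f s' IHs'] k' s1 v1 /=.
  have /= f1 := s1 0%N; rewrite v1 // f1 mul1g IHs' // => [j|j ltj].
    exact: s1 j.+1.
  by apply: v1; apply: ltnW.
elim: s k i => [//|f s IHs] k [|i] s1 /= lti.
  rewrite addn0 eqxx prod1 ?mulg1 // => [j|j ltj]; first exact: s1 j.+1.
  by rewrite gtn_eqF.
have /= f1 := s1 0%N; rewrite -[X in X == _]addn0 eqn_add2l /= f1 mul1g.
by rewrite addnS -addSn IHs // => j; apply: s1 j.+1.
Qed.

(** Addresses are endomorphisms and fix 1, so setting all variables but one to 1 isolates a single
    address. *)
Lemma satisfies_bracketing T T' : leaves T = leaves T' ->
  satisfies op (bracketing T) (bracketing T') <->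
  addresses a b id T = addresses a b id T'.
Proof.
move=> eqT; have idM : {morph (@id G) : x y / x * y} by [].
split=> [sat|eqa v].
  apply: (@eq_from_nth _ id) => [|i]; first by rewrite !size_addresses.
  rewrite size_addresses => lti; apply/funext => g.
  (* Variables are numbered from 1, list positions from 0. *)
  have := sat (fun j => if j == (1 + i)%N then g else 1).
  rewrite -[LHS]/(id _) -[RHS]/(id _) !(eval_bracketing _ _ _ idM).
  by rewrite !ordered_prod_single ?size_addresses -?eqT // => j;
    apply: nth_addresses1.
rewrite -[LHS]/(id _) -[RHS]/(id _) !(eval_bracketing _ _ _ idM).
by rewrite eqa.
Qed.

Lemma fine_spectrum_linear (a' b' : G -> G) :
  cancel a a' -> cancel a' a -> cancel b b' -> cancel b' b ->
  fine_spectrum op = sim (stab a a' b b').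
Proof.
move=> aK a'K bK b'K; apply/seteqP; split=> -[T T'].
  move=> [/= eqT /(satisfies_bracketing eqT)].
  by move=> /(addresses_eq aK a'K bK b'K eqT)/simE.
move=> simT; have [/= eqT _] := simT; split=> //=.
by apply/(satisfies_bracketing eqT)/(addresses_eq aK a'K bK b'K eqT)/simE.
Qed.

End LinearQuasigroups.

(** * Shifts of periodic functions *)

Section PeriodicFunctions.
Variable L : set (int * int).

(** These are the functions from the quotient of the lattice by [L] to the two-element group, with
    exclusive or as addition. Being boolean, the predicate makes [periodic] a subtype with a choice
    structure. *)
Definition is_periodic (f : int * int -> bool) : bool :=
  `[< forall u v : int * int, L v -> f (u + v) = f u >].

Record periodic := Periodic {
  periodic_fun :> int * int -> bool; _ : is_periodic periodic_fun }.

HB.instance Definition _ := [isSub for periodic_fun].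
HB.instance Definition _ := [Choice of periodic by <:].

Lemma periodicP (f : periodic) u v : L v -> f (u + v) = f u.
Proof. by case: f => f /= /asboolP; apply. Qed.

Lemma periodic_ext (f g : periodic) : f =1 g -> f = g.
Proof. by move=> fg; apply: val_inj; apply/funext. Qed.

Fact periodic_add_subproof (f g : periodic) :
  is_periodic (fun u => f u (+) g u).
Proof. by apply/asboolP => u v Lv; rewrite !periodicP. Qed.

Definition periodic_add f g := Periodic (periodic_add_subproof f g).

Fact periodic0_subproof : is_periodic (fun=> false).
Proof. by apply/asboolP. Qed.

Definition periodic0 := Periodic periodic0_subproof.

Fact shift_subproof (w : int * int) (f : periodic) :
  is_periodic (fun u => f (u + w)).
Proof. by apply/asboolP => u v Lv; rewrite addrAC (periodicP f _ Lv). Qed.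

Definition shift w f := Periodic (shift_subproof w f).

Fact periodic_addA : associative periodic_add.
Proof. by move=> f g h; apply: periodic_ext => u /=; rewrite addbA. Qed.

Fact periodic_add0 : right_id periodic0 periodic_add.
Proof. by move=> f; apply: periodic_ext => u /=; rewrite addbF. Qed.

Fact periodic_0add : left_id periodic0 periodic_add.
Proof. by move=> f; apply: periodic_ext. Qed.

Fact periodic_addK : left_inverse periodic0 id periodic_add.
Proof. by move=> f; apply: periodic_ext => u /=; rewrite addbb. Qed.

HB.instance Definition _ := isGroup.Build periodic
  periodic_addA periodic_0add periodic_add0 periodic_addK periodic_addK.

Lemma shift_comp v w f : shift v (shift w f) = shift (v + w) f.
Proof. by apply: periodic_ext => u /=; rewrite addrA. Qed.

Lemma shift0 f : shift 0 f = f.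
Proof. by apply: periodic_ext => u /=; rewrite addr0. Qed.

Lemma shiftK w : cancel (shift w) (shift (- w)).
Proof. by move=> f; rewrite shift_comp addNr shift0. Qed.

Lemma shiftNK w : cancel (shift (- w)) (shift w).
Proof. by move=> f; rewrite shift_comp subrr shift0. Qed.

Lemma ziter_shift w n f : ziter (shift w) (shift (- w)) n f = shift (w *~ n) f.
Proof.
rewrite (ziter_unique (shiftK w) (shiftNK w) (F := fun k => shift (w *~ k) f)).
  by rewrite mulr0z shift0.
by move=> k; rewrite shift_comp mulrzDr addrC mulr1z.
Qed.

Hypothesis subL : subgroup L.

Fact indicator_subproof : is_periodic (fun u => `[< L u >]).
Proof.
apply/asboolP => u v Lv; apply/asboolP/asboolP => Lu.
  by rewrite -(addrK v u); apply: subgroupB.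
by apply: subgroupD.
Qed.

Definition indicator := Periodic indicator_subproof.

(** Shifts commute, so [stab] consists of the vectors whose shift fixes all [L]-periodic functions;
    the indicator of [L] is fixed only by those in [L]. *)
Lemma stab_shift : stab (shift (1, 0)) (shift (- (1, 0)))
                        (shift (0, 1)) (shift (- (0, 1))) = L.
Proof.
apply/seteqP; split=> z.
  move=> /(_ indicator); rewrite !ziter_shift /= !shift_comp.
  (* The point [(1, -1)] cancels the shift by [(-1, 1)] that [c] performs. *)
  move=> /(congr1 (fun f : periodic => f (1, -1))) /=.
  have -> : (1, -1) + (- (1, 0) + (0, 1)) = 0 :> (int * int)%type by int2.
  rewrite (asboolT (subgroup0 subL)) => /asboolP H; apply: (eq_ind _ L H).
  by rewrite !mulrz_pair; int2.
move=> Lz f; rewrite !ziter_shift /= !shift_comp; apply: periodic_ext => u /=.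
rewrite -[RHS](periodicP _ _ Lz); congr (periodic_fun f _).
by rewrite !mulrz_pair; int2.
Qed.

Lemma FS_sim : FS (sim L).
Proof.
have shiftM w : {morph shift w : f g / (f * g)%g}.
  by move=> f g; apply: periodic_ext.
exists periodic, (fun f g => (shift (1, 0)%R f * shift (0, 1)%R g)%g); split.
  exists (shift (1, 0)), (shift (0, 1)); split=> //; split=> //.
    by exists (shift (- (1, 0))); [apply: shiftK|apply: shiftNK].
  by exists (shift (- (0, 1))); [apply: shiftK|apply: shiftNK].
rewrite (fine_spectrum_linear (shiftM _) (shiftM _)
  (shiftK _) (shiftNK _) (shiftK _) (shiftNK _)).
by rewrite stab_shift.
Qed.

End PeriodicFunctions.

(** * Classification of the spectra and the lattice *)

Lemma FSP R : FS R <-> exists2 L, Sub2_0 L & R = sim L.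
Proof.
split=> [[G [op [[a [b [[aM [a' aK a'K]] [bM [b' bK b'K]] opE]]] ->]]]|].
  have -> : op = fun x y => (a x * b y)%g by apply/funext => x; apply/funext.
  rewrite (fine_spectrum_linear aM bM aK a'K bK b'K).
  have subS := stab_subgroup aK a'K bK b'K.
  have [|[p [q [pq0 S0]]]] := subgroup_dichotomy subS.
    by exists (stab a a' b b') => //; left.
  (* A stabilizer of rank at most 1 yields equality of trees, which is also the relation of the
     trivial subgroup. *)
  exists [set 0]; first by right.
  apply/seteqP; split=> -[T T'].
    by move=> /(sim_weight0 pq0 S0) ->; rewrite sim_set0.
  by apply: simS => u ->; apply: subgroup0.
by move=> [L /Sub2_0_subgroup subL ->]; apply: FS_sim.
Qed.

Theorem theorem6p3 :
  is_lattice FS /\ order_iso Sub2_0 FS sim /\ preserves_meets Sub2_0 sim.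
Proof.
split; [|split; [split; [split|]|]].
- move=> _ _ /FSP[L sL ->] /FSP[M sM ->]; split.
    exists (sim (L `&` M)); split.
    + by apply/FSP; exists (L `&` M) => //; apply: Sub2_0I.
    + by apply: simS => u [].
    + by apply: simS => u [].
    + by move=> C _ CL CM; rewrite simI => p Cp; split; [apply: CL|apply: CM].
  (* The join comes from the subgroup generated by both; it is least because inclusions of spectra
     reflect to subgroups. *)
  exists (sim (smallest subgroup (L `|` M))); split.
  + apply/FSP; exists (smallest subgroup (L `|` M)) => //.
    exact: Sub2_0_smallestU.
  + by apply: simS => u Lu; apply: sub_gen_smallest; left.
  + by apply: simS => u Mu; apply: sub_gen_smallest; right.
  + move=> _ /FSP[K sK ->] LK MK; apply: simS.
    apply: smallest_sub; first exact: Sub2_0_subgroup.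
    by move=> u [Lu|Mu]; [apply: sim_reflects_sub LK _ Lu
      |apply: sim_reflects_sub MK _ Mu].
- by move=> L sL; apply/FSP; exists L.
- move=> L M; rewrite !inE => sL sM eqLM.
  by apply/seteqP; split; apply: sim_reflects_sub => //; rewrite eqLM.
- by move=> R /FSP[L sL ->]; exists L.
- move=> L M sL sM; split; [exact: simS|exact: sim_reflects_sub].
- by move=> L M sL sM; split; [apply: Sub2_0I|apply: simI].
Qed.
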